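(* Consider either the white noise model or the Gaussian sequence model with noise level $n^{-1/2}$, and let $T$ be a linear functional. Suppose $\mathcal{F}$ and $\mathcal{G}$ are convex and closed with $\mathcal{F}\cap\mathcal{G}\ne\varnothing$ and $\omega(1,\mathcal{F},\mathcal{G})>0$. Let $V\ge 0$ be such that $0<\varepsilon(V,\mathcal{F},\mathcal{G})<\infty$, and suppose there are $f\in\mathcal{F}$, $g\in\mathcal{G}$ such that $$\|g-f\|_2=\varepsilon(V,\mathcal{F},\mathcal{G})=:\varepsilon_V\quad\text{and}\quad Tg-Tf=\omega(\varepsilon_V,\mathcal{F},\mathcal{G}).$$ Let $u=\frac{g-f}{\varepsilon_V}$ and $$a=T\Big(\frac{f+g}2\Big)-\sqrt{nV}\Big\langle u,\frac{f+g}2\Big\rangle .$$ Then the estimator $$\hat T_V=a+\sqrt{nV}\int u(t)\,dY(t)$$ in the white noise model, and the estimator $$\hat T_V=a+\sqrt{nV}\sum_i u(i)Y(i)$$ in the sequence model, have constant variance $E(\hat T_V-E\hat T_V)^2=V$, and satisfy $$\sup_{h\in\mathcal{F}}\big(E_h\hat T_V-Th\big)=B(V,\mathcal{F},\mathcal{G})\quad\text{and}\quad \inf_{h\in\mathcal{G}}\big(E_h\hat T_V-Th\big)=-B(V,\mathcal{F},\mathcal{G}).$$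
   Context: White noise model: one observes $dY(t)=f(t)\,dt+n^{-1/2}dW(t)$ on an interval, $W$ a standard Brownian motion. Sequence model: one observes $Y(i)=f(i)+n^{-1/2}\varepsilon_i$, $\varepsilon_i$ i.i.d. standard normal. $\langle\cdot,\cdot\rangle$ and $\|\cdot\|_2$ are the $L_2$ (resp. $\ell_2$) inner product and norm; parameter sets are subsets of this Hilbert space, ''closed'' is with respect to $\|\cdot\|_2$, and $T$ is a linear functional on a linear space containing the parameter sets. $E_h$ is expectation when the true parameter is $h$; for $u$ in the Hilbert space, $\int u\,dY$ (resp. $\sum_i u(i)Y(i)$) is, under $h$, normal with mean $\langle u,h\rangle$ and variance $\|u\|_2^2/n$. Ordered modulus: $\omega(\varepsilon,\mathcal{F},\mathcal{G})=\sup\{Tg-Tf:\|g-f\|_2\le\varepsilon,\ f\in\mathcal{F},\ g\in\mathcal{G}\}$. For $V\ge0$, $B(V,\mathcal{F},\mathcal{G})=\frac12\sup_{\varepsilon>0}\big(\omega(\varepsilon,\mathcal{F},\mathcal{G})-\sqrt{nV}\,\varepsilon\big)$. The quantity $\varepsilon(V,\mathcal{F},\mathcal{G})$ is defined as follows. Case 1: if $0<B(V,\mathcal{F},\mathcal{G})<\infty$, it is the smallest $\varepsilon\ge0$ at which $\omega(\varepsilon,\mathcal{F},\mathcal{G})-\sqrt{nV}\,\varepsilon$ attains its maximum (it is $\infty$ if the supremum is approached only as $\varepsilon\to\infty$). Case 2: if $B(V,\mathcal{F},\mathcal{G})=0$ and $B(V',\mathcal{F},\mathcal{G})>0$ for all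 $0\le V'<V$, then (a) if $\omega(\varepsilon,\mathcal{F},\mathcal{G})=\sqrt{nV}\,\varepsilon$ on some interval $0\le\varepsilon\le\varepsilon_0$ with $\varepsilon_0>0$, it is the largest $\varepsilon\le\frac1{\sqrt n}$ with $\omega(\varepsilon,\mathcal{F},\mathcal{G})=\sqrt{nV}\,\varepsilon$; (b) if $\omega(\varepsilon,\mathcal{F},\mathcal{G})<\sqrt{nV}\,\varepsilon$ for all $\varepsilon>0$, it is $0$. The hypothesis $0<\varepsilon(V,\mathcal{F},\mathcal{G})<\infty$ thus means that $V$ is in Case 1 with finite positive maximizer or in Case 2(a). *)

(* Defs.v *)
From HB Require Import structures.
From mathcomp Require Import all_boot all_order all_algebra.
From mathcomp Require Import all_classical all_reals all_analysis.

Set Implicit Arguments.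
Unset Strict Implicit.
Unset Printing Implicit Defensive.
Import Order.TTheory GRing.Theory Num.Theory.
Import numFieldNormedType.Exports.
Local Open Scope classical_set_scope.
Local Open Scope ring_scope.

(* The Hilbert space L_2(mu).  Its elements are square-integrable functions,
   not classes of functions: [norm2] below is a seminorm, and compatibility with
   a.e. equality is imposed where it matters (see [linear_functional]; a set
   that is [closed2] is automatically stable under a.e. equality). *)
Notation L2 mu := (LfunType mu (lee1n 2)).

(* L_2 of an interval and l_2; for the counting measure on nat a.e. equality is
   equality. *)
Notation itv_measure R I :=
  (mrestr (@lebesgue_measure R) (measurable_itv I)).
Notation L2_itv R I := (L2 (itv_measure R I)).
Notation l2 R := (L2 (@counting nat R)).

Section hilbert.
Context d (X : measurableType d) (R : realType) (mu : {measure set X -> \bar R}).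
Implicit Types (f g : L2 mu) (A : set (L2 mu)).

Definition dot2 f g : R := \int[mu]_x (f x * g x).
Definition norm2 f : R := fine ('N[mu]_2%:E[EFin \o f])%E.

Definition closed2 A :=
  forall f, (forall e : R, 0 < e -> exists2 g, A g & norm2 (g - f) < e) -> A f.

Definition linear_subspace (D : set (L2 mu)) :=
  D 0 /\ forall (a : R) f g, D f -> D g -> D (a *: f + g).

(* T is a linear functional on D; it only has to be meaningful on D, and it
   depends on the a.e. class of its argument only. *)
Definition linear_functional (D : set (L2 mu)) (T : L2 mu -> R) :=
  [/\ linear_subspace D,
      (forall (a : R) f g, D f -> D g -> T (a *: f + g) = a * T f + T g) &
      (forall f g, D f -> D g -> (f : X -> R) = g %[ae mu] -> T f = T g)].

End hilbert.

Section modulus.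
Context d (X : measurableType d) (R : realType) (mu : {measure set X -> \bar R}).
Variables (T : L2 mu -> R) (F G : set (L2 mu)) (n : R).
Local Open Scope ereal_scope.

(* The supremum is taken in the extended reals. *)
Definition omega (e : R) : \bar R :=
  ereal_sup [set x | exists f g,
    [/\ F f, G g, (norm2 (g - f) <= e)%R & x = (T g - T f)%:E]].

Definition penalized (V e : R) : \bar R :=
  omega e - (Num.sqrt (n * V) * e)%:E.

Definition bias (V : R) : \bar R :=
  (2^-1)%:E * ereal_sup [set penalized V e | e in [set e : R | (0 < e)%R]].

Definition maximizer (V e : R) :=
  (0 <= e)%R /\ forall e' : R, (0 <= e')%R -> penalized V e' <= penalized V e.

Definition eps_case1 (V : R) := 0 < bias V < +oo.

Definition eps_case2 (V : R) :=
  bias V = 0 /\ forall V' : R, (0 <= V' < V)%R -> 0 < bias V'.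

Definition omega_touches (V e : R) := omega e = (Num.sqrt (n * V) * e)%:E.

(* [is_eps V x] : the quantity epsilon(V, F, G) is defined and equal to x.  In
   the case x = +oo, the condition says that the supremum is not approached on
   any bounded range of e. *)
Definition is_eps (V : R) (x : \bar R) : Prop :=
  [\/ eps_case1 V /\
        (exists2 e : R, x = e%:E &
           maximizer V e /\ forall e', maximizer V e' -> (e <= e')%R),
      [/\ eps_case1 V, x = +oo &
        forall M : R,
          ereal_sup [set penalized V e | e in [set e : R | (0 < e <= M)%R]] <
          ereal_sup [set penalized V e | e in [set e : R | (0 < e)%R]]],
      [/\ eps_case2 V,
        (exists2 e0 : R, (0 < e0)%R &
           forall e, (0 <= e <= e0)%R -> omega_touches V e) &
        (exists e : R,
           [/\ x = e%:E, (0 <= e <= (Num.sqrt n)^-1)%R, omega_touches V e &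
               forall e', (0 <= e' <= (Num.sqrt n)^-1)%R ->
                 omega_touches V e' -> (e' <= e)%R])] |
      [/\ eps_case2 V, x = 0 &
        forall e : R, (0 < e)%R -> omega e < (Num.sqrt (n * V) * e)%:E]].

End modulus.

Section probability.
Context d (Omega : measurableType d) (R : realType) (P : probability Omega R).

Definition mutually_independent (I : eqType) (Z : I -> Omega -> R) :=
  forall (s : seq I) (A : I -> set R), uniq s ->
    (forall i, measurable (A i)) ->
    P (\bigcap_(i in [set` s]) (Z i @^-1` A i)) =
    (\prod_(i <- s) P (Z i @^-1` A i))%E.

(* s is the standard deviation; [normal_prob] degenerates to a uniform law for
   s = 0, so this is only used with s > 0. *)
Definition gaussian (Z : Omega -> R) (m s : R) :=
  forall A : set R, measurable A -> P (Z @^-1` A) = normal_prob m s A.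

(* A nondecreasing sequence of points of I; only finitely many of them are used
   at a time. *)
Definition grid (I : interval R) (t : nat -> R) :=
  (forall k, t k \in I) /\ {homo t : j k / (j <= k)%N >-> j <= k}.

(* Standard Brownian motion on I, up to its starting value: only dW is used. *)
Definition brownian_motion (I : interval R) (W : R -> {mfun Omega >-> R}) :=
  [/\ (forall s t, s \in I -> t \in I -> s < t ->
         gaussian (fun w => W t w - W s w) 0 (Num.sqrt (t - s))),
      (forall t, grid I t ->
         mutually_independent (fun (k : nat) w => W (t k.+1) w - W (t k) w)) &
      {ae P, forall w, {within [set` I], continuous (fun t => W t w)}}].

(* dY(t) = h(t) dt + n^{-1/2} dW(t) on I, under P. *)
Definition white_noise (I : interval R) (n : R) (h : R -> R)
    (Y : R -> {mfun Omega >-> R}) :=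
  exists2 W, brownian_motion I W &
    forall s t, s \in I -> t \in I -> s <= t -> forall w,
      Y t w - Y s w = (\int[lebesgue_measure]_(x in `[s, t]) h x)
                      + (Num.sqrt n)^-1 * (W t w - W s w).

Definition step_fun (m : nat) (c t : nat -> R) (x : R) : R :=
  \sum_(k < m) c k * \1_(`]t k, t k.+1]) x.

Definition step_integral (Y : R -> {mfun Omega >-> R}) (m : nat) (c t : nat -> R)
    (w : Omega) : R :=
  \sum_(k < m) c k * (Y (t k.+1) w - Y (t k) w).

(* Z is (a version of) the stochastic integral of u against dY over I: an
   L_2(P)-limit of the integrals of step functions converging to u in L_2(I). *)
Definition is_stoch_integral (I : interval R) (Y : R -> {mfun Omega >-> R})
    (u : R -> R) (Z : {mfun Omega >-> R}) :=
  exists (m : nat -> nat) (c t : nat -> nat -> R),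
    [/\ (forall j, grid I (t j)),
        ('N[itv_measure R I]_2%:E[EFin \o
            (fun x => step_fun (m j) (c j) (t j) x - u x)%R] @[j --> \oo]
          --> 0)%E &
        ('N[P]_2%:E[EFin \o
            (fun w => step_integral Y (m j) (c j) (t j) w - Z w)%R] @[j --> \oo]
          --> 0)%E].

(* Y(i) = h(i) + n^{-1/2} xi(i), under P. *)
Definition gaussian_sequence (n : R) (h : nat -> R)
    (Y : nat -> {mfun Omega >-> R}) :=
  exists xi : nat -> {mfun Omega >-> R},
    [/\ mutually_independent xi,
        (forall i, gaussian (xi i) 0 1) &
        forall i w, Y i w = h i + (Num.sqrt n)^-1 * xi i w].

(* Z is (a version of) the almost surely convergent sum of u(i) Y(i). *)
Definition is_series_sum (Y : nat -> {mfun Omega >-> R}) (u : nat -> R)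
    (Z : {mfun Omega >-> R}) :=
  {ae P, forall w, series (fun i => u i * Y i w) @ \oo --> Z w}.

End probability.

(* Main.v *)
(** The bias of the affine estimator at [h] is [a + s <u, h> - T h] with
    [s = sqrt (n V)].  With [K = sup_e (omega e - s e)], every pair [f' \in F],
    [g' \in G] satisfies [T g' - T f' <= K + s |g' - f'|], with equality at
    [(f, g)] since [eps_V] attains the supremum.  Moving [f] (or [g]) along a
    segment inside the convex set and differentiating this inequality at the
    extremal pair shows that the bias over [F] is largest at [f], and over [G]
    smallest at [g], where it equals [K / 2] and [- K / 2].

    The mean [<u, h>] and variance [|u|^2 / n] of [int u dY] pass to the limit
    in L_2(P) from finite sums of uncorrelated Gaussian variables; in the
    sequence model almost sure convergence is upgraded to L_2 convergence by
    Fatou's lemma.  Only the first two moments of the noise matter. *)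
Require Import Defs.
From HB Require Import structures.
From mathcomp Require Import all_boot all_order all_algebra.
From mathcomp Require Import all_classical all_reals all_analysis.
From mathcomp Require Import measurable_realfun ring lra.

Set Implicit Arguments.
Unset Strict Implicit.
Unset Printing Implicit Defensive.
Import Order.TTheory GRing.Theory Num.Theory.
Import numFieldNormedType.Exports.
Local Open Scope classical_set_scope.
Local Open Scope ring_scope.

(** * Square-integrable functions *)

Section inner_product.
Context d (X : measurableType d) (R : realType) (mu : {measure set X -> \bar R}).
Implicit Types f g h : X -> R.
Local Notation Lfun2 := (Lfun mu 2%:E).

(** Takes bare functions, so that it serves random variables under [P] as well as elements of
    [L2 mu], where it is convertible to [dot2]. *)
Definition ip f g : R := \int[mu]_x (f x * g x).

Lemma Lfun2_mulr_integrable f g : f \in Lfun2 -> g \in Lfun2 ->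
  mu.-integrable setT (EFin \o (fun x => f x * g x)).
Proof. by move=> f2 g2; apply/Lfun1_integrable; exact: Lfun2_mul_Lfun1. Qed.

Lemma Lfun2D f g : f \in Lfun2 -> g \in Lfun2 -> f \+ g \in Lfun2.
Proof.
move=> f2 g2; have [_ /(_ 1 f g f2 g2)] := Lfun_submod_closed mu (lee1n 2).
by rewrite scale1r.
Qed.

Lemma Lfun2Z a f : f \in Lfun2 -> (fun x => a * f x) \in Lfun2.
Proof.
move=> f2; have [f0 /(_ a f 0 f2)] := Lfun_submod_closed mu (lee1n 2).
by rewrite addr0; apply.
Qed.

Lemma Lfun2B f g : f \in Lfun2 -> g \in Lfun2 -> f \- g \in Lfun2.
Proof.
move=> f2 g2; rewrite (_ : f \- g = f \+ (fun x => -1 * g x)).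
  by apply: Lfun2D => //; exact: Lfun2Z.
by apply/funext => x /=; rewrite mulN1r.
Qed.

Lemma ipC f g : ip f g = ip g f.
Proof. by apply: eq_Rintegral => x _; rewrite mulrC. Qed.

Lemma ipDl f g h : f \in Lfun2 -> g \in Lfun2 -> h \in Lfun2 ->
  ip (f \+ g) h = ip f h + ip g h.
Proof.
move=> f2 g2 h2; rewrite /ip -RintegralD//; [|exact: Lfun2_mulr_integrable..].
by apply: eq_Rintegral => x _ /=; rewrite mulrDl.
Qed.

Lemma ipZl a f g : f \in Lfun2 -> g \in Lfun2 ->
  ip (fun x => a * f x) g = a * ip f g.
Proof.
move=> f2 g2; rewrite /ip -RintegralZl//; last exact: Lfun2_mulr_integrable.
by apply: eq_Rintegral => x _ /=; rewrite mulrA.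
Qed.

Lemma ipBl f g h : f \in Lfun2 -> g \in Lfun2 -> h \in Lfun2 ->
  ip (f \- g) h = ip f h - ip g h.
Proof.
move=> f2 g2 h2; rewrite /ip -RintegralB//; [|exact: Lfun2_mulr_integrable..].
by apply: eq_Rintegral => x _ /=; rewrite mulrBl.
Qed.

Lemma ip_ge0 f : 0 <= ip f f.
Proof. by apply: Rintegral_ge0 => x _; rewrite -expr2 sqr_ge0. Qed.

Lemma ipE f : f \in Lfun2 -> (ip f f)%:E = (\int[mu]_x (f x ^+ 2)%:E)%E.
Proof.
move=> f2; rewrite /ip /Rintegral fineK; last first.
  by apply: integrable_fin_num => //; exact: Lfun2_mulr_integrable.
by apply: eq_integral => x _; rewrite expr2.
Qed.

(** Stays in the extended reals, so that it can also be used to establish finiteness of the norm, as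
    in [Lfun2P]. *)
Lemma sqr_Lnorm2 f :
  ('N[mu]_2%:E[EFin \o f] `^ 2 = \int[mu]_x (f x ^+ 2)%:E)%E.
Proof.
rewrite powR_Lnorm//; apply: eq_integral => x _.
by rewrite abse_EFin poweR_EFin powR_mulrn// real_normK// num_real.
Qed.

Lemma Lnorm2_sqrt f : f \in Lfun2 ->
  ('N[mu]_2%:E[EFin \o f])%E = (Num.sqrt (ip f f))%:E.
Proof.
move=> f2; have N0 := Lnorm_ge0 mu 2%:E (EFin \o f).
have Nfin : ('N[mu]_2%:E[EFin \o f])%E \is a fin_num.
  by rewrite ge0_fin_numE//; move: f2 => /andP[_]; rewrite inE.
have := sqr_Lnorm2 f; rewrite -ipE//.
case: ('N[mu]_2%:E[EFin \o f])%E Nfin N0 => //= r _ r0 [<-].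
by rewrite powR_mulrn// sqrtr_sqr ger0_norm.
Qed.

Lemma Lfun2P f : measurable_fun setT f ->
  (\int[mu]_x (f x ^+ 2)%:E < +oo)%E -> f \in Lfun2.
Proof.
move=> mf; rewrite -sqr_Lnorm2 => f2.
rewrite inE; apply/andP; split; rewrite inE//= /finite_norm.
move: f2; have := Lnorm_ge0 mu 2%:E (EFin \o f).
by case: ('N[mu]_2%:E[EFin \o f])%E => [r _ _|_|//]; rewrite ?ltry// poweRyr.
Qed.

Lemma ip_cauchy_schwarz f g : f \in Lfun2 -> g \in Lfun2 ->
  `|ip f g| <= Num.sqrt (ip f f) * Num.sqrt (ip g g).
Proof.
move=> f2 g2; have ifg := Lfun2_mulr_integrable f2 g2.
apply: (le_trans (le_normr_Rintegral _ ifg)) => //.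
rewrite -lee_fin EFinM -!Lnorm2_sqrt// /Rintegral fineK; last first.
  apply: integrable_fin_num => //.
  exact: (integrable_abse ifg).
have := @hoelder _ _ _ mu f g 2 2; rewrite Lnorm1; apply => //.
- by move: f2; rewrite inE => /andP[/[!inE]].
- by move: g2; rewrite inE => /andP[/[!inE]].
- by rewrite [RHS]splitr !div1r.
Qed.

End inner_product.

(** * Mean-square convergence and continuity of the inner product *)

Section L2_limits.
Context d (X : measurableType d) (R : realType) (mu : {measure set X -> \bar R}).
Implicit Types f g h : X -> R.
Local Notation Lfun2 := (Lfun mu 2%:E).
Local Notation ip := (ip mu).

Definition L2_cvg (f_ : nat -> X -> R) f :=
  ip (f_ j \- f) (f_ j \- f) @[j --> \oo] --> (0 : R).

Lemma Lnorm2_cvg (f_ : nat -> X -> R) f :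
  (forall j, f_ j \in Lfun2) -> measurable_fun setT f ->
  ('N[mu]_2%:E[EFin \o (f_ j \- f)%R] @[j --> \oo] --> 0)%E ->
  f \in Lfun2 /\ L2_cvg f_ f.
Proof.
move=> f2 mf cvN.
have [/= j Nj] : exists j, ('N[mu]_2%:E[EFin \o (f_ j \- f)%R] < +oo)%E.
  have [k _ Hk] : \forall j \near \oo,
      ('N[mu]_2%:E[EFin \o (f_ j \- f)%R] < +oo)%E.
    move: cvN => /fine_cvgP[+ _]; apply: filterS => k.
    by rewrite ge0_fin_numE ?Lnorm_ge0.
  by exists k; apply: Hk => /=.
have fL : f \in Lfun2.
  have mj : measurable_fun setT (f_ j).
    by have := f2 j; rewrite inE => /andP[/[!inE]].
  have jL : f_ j \- f \in Lfun2.
    by rewrite inE; apply/andP; split; rewrite inE//=; exact: measurable_funB.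
  have -> : f = f_ j \- (f_ j \- f) by apply/funext => x /=; rewrite subKr.
  exact: Lfun2B.
split => //; rewrite /L2_cvg.
have -> : (fun j => ip (f_ j \- f) (f_ j \- f)) =
    (fun j => fine 'N[mu]_2%:E[EFin \o (f_ j \- f)%R] ^+ 2).
  apply/funext => j'; rewrite Lnorm2_sqrt; last exact: Lfun2B.
  by rewrite /= sqr_sqrtr// ip_ge0.
have cv0 : fine 'N[mu]_2%:E[EFin \o (f_ j \- f)%R] @[j --> \oo] --> (0 : R).
  exact: (fine_cvg cvN).
by rewrite -(mulr0 0); under eq_fun do rewrite expr2; apply: cvgM.
Qed.

Variables (f_ : nat -> X -> R) (f : X -> R).
Hypotheses (f2_ : forall j, f_ j \in Lfun2) (f2 : f \in Lfun2).
Hypothesis cvf : L2_cvg f_ f.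

(** Cauchy-Schwarz bounds [ip (f_ j \- f) g] by the distance from [f_ j] to [f] times the norm of
    [g]. *)
Lemma ip_cvg g : g \in Lfun2 -> ip (f_ j) g @[j --> \oo] --> ip f g.
Proof.
move=> g2.
have cvs : Num.sqrt (ip (f_ j \- f) (f_ j \- f)) * Num.sqrt (ip g g)
    @[j --> \oo] --> (0 : R).
  rewrite -(mul0r (Num.sqrt (ip g g))); apply: cvgM; last exact: cvg_cst.
  rewrite -[X in _ --> X]sqrtr0.
  by apply: continuous_cvg => //; exact: sqrt_continuous.
apply/cvgrPdistC_lt; move/cvgr0Pnorm_lt : cvs => cvs e /cvs; apply: filterS => j.
apply: le_lt_trans; rewrite -ipBl// [leRHS]ger0_norm ?mulr_ge0//.
by apply: ip_cauchy_schwarz => //; exact: Lfun2B.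
Qed.

Lemma ip_sqr_cvg : ip (f_ j) (f_ j) @[j --> \oo] --> ip f f.
Proof.
(* Expanding the square of [f_ j - f] leaves a vanishing term and an inner product against the fixed
   function [f]. *)
have E j : ip (f_ j) (f_ j) =
    ip (f_ j \- f) (f_ j \- f) + (2 * ip (f_ j) f - ip f f).
  rewrite ipBl//; last exact: Lfun2B.
  rewrite !(ipC _ _ (f_ j \- f)) !ipBl// (ipC _ f (f_ j)); ring.
rewrite (funext E).
rewrite [X in _ --> X](_ : _ = 0 + (2 * ip f f - ip f f)); last by ring.
apply: cvgD => //; apply: cvgB; last exact: cvg_cst.
by apply: cvgM; [exact: cvg_cst|exact: (ip_cvg f2)].
Qed.

End L2_limits.

(** * Linear combinations of orthogonal functions *)

Section orthogonal_sums.
Context d (T : measurableType d) (R : realType) (P : {measure set T -> \bar R}).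
Variable xi : nat -> T -> R.
Hypothesis xi2 : forall k, xi k \in Lfun P 2%:E.

Lemma Lfun2_sum (c : nat -> R) m :
  (fun w => \sum_(k < m) c k * xi k w) \in Lfun P 2%:E.
Proof.
elim: m => [|m ih].
  have -> : (fun w => \sum_(k < 0) c k * xi k w) = (fun w => 0 * xi 0%N w).
    by apply/funext => w; rewrite big_ord0 mul0r.
  exact: Lfun2Z.
rewrite (_ : (fun w => _) = (fun w => \sum_(k < m) c k * xi k w) \+
    (fun w => c m * xi m w)); last by apply/funext => w; rewrite big_ord_recr.
by apply: Lfun2D => //; exact: Lfun2Z.
Qed.

Lemma ip_suml (c : nat -> R) m g : g \in Lfun P 2%:E ->
  ip P (fun w => \sum_(k < m) c k * xi k w) g = \sum_(k < m) c k * ip P (xi k) g.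
Proof.
move=> g2; elim: m => [|m ih].
  rewrite big_ord0 /ip (@eq_Rintegral _ _ _ P _ (cst 0)) ?Rintegral_cst ?mul0r//.
  by move=> w _; rewrite big_ord0 mul0r.
rewrite (_ : (fun w => _) = (fun w => \sum_(k < m) c k * xi k w) \+
    (fun w => c m * xi m w)); last by apply/funext => w; rewrite big_ord_recr.
rewrite ipDl//; [|exact: Lfun2_sum|exact: Lfun2Z].
by rewrite ih big_ord_recr ipZl.
Qed.

(** Pythagoras. The measure is arbitrary because the identity serves both for noise variables under
    [P] and for indicators of cells of an interval. *)
Lemma ip_sum_orthogonal (c v : nat -> R) m :
  (forall k l, k != l -> ip P (xi k) (xi l) = 0) ->
  (forall k, ip P (xi k) (xi k) = v k) ->
  let S := fun w => \sum_(k < m) c k * xi k w in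
  ip P S S = \sum_(k < m) c k ^+ 2 * v k.
Proof.
move=> xi0 xiv S; rewrite {1}/S ip_suml; last exact: Lfun2_sum.
apply: eq_bigr => k _; rewrite ipC ip_suml//.
rewrite (bigD1 k)//= big1 ?addr0 => [|l lk]; first by rewrite xiv; ring.
by rewrite xi0 ?mulr0.
Qed.

End orthogonal_sums.

(** * Mean and variance as inner products, and their limits *)

Section moments.
Context d (T : measurableType d) (R : realType) (P : probability T R).
Implicit Types Z : T -> R.

Lemma Lfun2_cst (c : R) : (fun=> c) \in Lfun P 2%:E.
Proof. exact: Lfun_cst. Qed.

Lemma Lfun2_Lfun1 Z : Z \in Lfun P 2%:E -> Z \in Lfun P 1.
Proof. by move=> Z2; apply: Lfun_subset12 => //; exact: fin_num_measure. Qed.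

Lemma expectation_ip Z : Z \in Lfun P 2%:E ->
  ('E_P[Z] = (ip P Z (fun=> 1))%:E)%E.
Proof.
move=> Z2; rewrite unlock /ip /Rintegral.
under [in RHS]eq_integral do rewrite mulr1.
rewrite fineK//; apply: integrable_fin_num => //.
by apply/Lfun1_integrable; exact: Lfun2_Lfun1.
Qed.

Lemma variance_ip Z : Z \in Lfun P 2%:E ->
  'V_P[Z] = (ip P Z Z - ip P Z (fun=> 1) ^+ 2)%:E.
Proof.
move=> Z2; have E := expectation_ip Z2; rewrite varianceE// E EFinB EFin_expe.
congr (_ - _)%E; rewrite unlock ipE//; apply: eq_integral => w _.
Qed.

(** Mean and second moment are inner products, hence continuous for mean-square convergence;
    uniqueness of limits then identifies those of [Z]. *)
Lemma L2_cvg_moments (X_ : nat -> T -> R) Z (m v : R) :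
  (forall j, X_ j \in Lfun P 2%:E) -> Z \in Lfun P 2%:E -> L2_cvg P X_ Z ->
  ip P (X_ j) (fun=> 1) @[j --> \oo] --> m ->
  ip P (X_ j) (X_ j) @[j --> \oo] --> m ^+ 2 + v ->
  ('E_P[Z] = m%:E)%E /\ 'V_P[Z] = v%:E.
Proof.
move=> X2 Z2 XZ Xm Xv; rewrite expectation_ip// variance_ip//.
have m1 : ip P Z (fun=> 1) = m.
  exact: (cvg_unique _ (ip_cvg X2 Z2 XZ (Lfun2_cst 1)) Xm).
have -> : ip P Z Z = m ^+ 2 + v.
  exact: (cvg_unique _ (ip_sqr_cvg X2 Z2 XZ) Xv).
by rewrite m1 addrAC subrr add0r.
Qed.

End moments.

(** * Gaussian variables and independence *)

Section normal_moments.
Variable R : realType.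
Local Notation mu := (@lebesgue_measure R).

Lemma ge0_integral_normal_prob (m s : R) (f : R -> \bar R) :
  (forall x, 0 <= f x)%E -> measurable_fun setT f ->
  (\int[normal_prob m s]_x f x = \int[mu]_x (f x * (normal_pdf m s x)%:E))%E.
Proof.
move=> f0 mf; have dom := @normal_prob_dominates R m s.
rewrite -(Radon_Nikodym_SigmaFinite.change_of_variables dom)//.
apply: ae_eq_integral => //.
- apply: emeasurable_funM => //.
  by apply: measurable_int; exact: (Radon_Nikodym_SigmaFinite.f_integrable dom).
- apply: emeasurable_funM => //; apply/measurable_EFinP.
  exact: measurable_normal_pdf.
(* The Radon-Nikodym derivative and [normal_pdf] have the same integral over every measurable set,
   so they agree almost everywhere. *)
- apply: ae_eqe_mul2l; apply: integral_ae_eq => //.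
  + exact: (Radon_Nikodym_SigmaFinite.f_integrable dom).
  + by apply/measurable_EFinP; exact: measurable_normal_pdf.
  + by move=> E _ mE; rewrite -(Radon_Nikodym_SigmaFinite.f_integral dom).
Qed.

Variables (s : R).
Hypothesis s0 : 0 < s.
Local Notation p := (normal_pdf 0 s).

Lemma normal_pdf0N x : p (- x) = p x.
Proof. by rewrite !normal_pdfE ?gt_eqF// /normal_fun !subr0 sqrrN. Qed.

(** The relation [p' = - (x / s^2) p] is what lets [x * p x] act as a primitive in the computation
    of the second moment. *)
Lemma is_derive_normal_pdf0 (x : R) : is_derive x 1 p (- (x / s ^+ 2) * p x).
Proof.
rewrite normal_pdfE ?gt_eqF//.
have d1 : is_derive x 1 (cst (- (s ^+ 2 *+ 2)^-1) * (id * id) : R -> R)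
    (- (x / s ^+ 2)).
  apply: is_derive_eq => /=.
  rewrite /GRing.scale /= mulr1; field; rewrite gt_eqF//.
have d2 := is_derive1_comp (is_derive_expR _) d1.
have d3 := is_deriveZ (normal_peak s) d2.
rewrite (_ : (fun x => _) = normal_peak s *: (expR \o
    (cst (- (s ^+ 2 *+ 2)^-1) * (id * id) : R -> R))); last first.
  apply/funext => y /=; rewrite /normal_fun subr0 mulNr.
  by congr (_ * expR _); rewrite /= !fctE /= -expr2; ring.
apply: is_derive_eq.
rewrite /= /normal_fun subr0 /GRing.scale /= !fctE /=.
have -> : - (s ^+ 2 *+ 2)^-1 * (x * x) = - x ^+ 2 / (s ^+ 2 *+ 2) by ring.
by ring.
Qed.

(* [F] is a primitive of [f], which is negative on [0, s[ and positive beyond: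
   applying the fundamental theorem of calculus on either side of [s] moves the
   same mass [- F s] across [s]. *)
Let F (x : R) : R := - s ^+ 2 * (x * p x).
Let f (x : R) : R := (x ^+ 2 - s ^+ 2) * p x.

Let is_derive_F (x : R) : is_derive x 1 F (f x).
Proof.
have dp := is_derive_normal_pdf0 x.
rewrite (_ : F = (- s ^+ 2) *: (id * p)); last by apply/funext.
apply: is_derive_eq.
by rewrite /f /GRing.scale /= mulr1; field; rewrite gt_eqF.
Qed.

Let continuous_F : continuous F.
Proof.
move=> x; apply: differentiable_continuous; apply/derivable1_diffP.
by have [] := is_derive_F x.
Qed.

Let continuous_sqr_pdf : continuous (fun x : R => x ^+ 2 * p x).
Proof.
move=> x; apply: cvgM; first exact: sqr_continuous.
by apply: continuous_normal_pdf; rewrite gt_eqF.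
Qed.

Let continuous_f : continuous f.
Proof.
move=> x; apply: cvgM; last by apply: continuous_normal_pdf; rewrite gt_eqF.
by apply: cvgB; [exact: sqr_continuous|exact: cvg_cst].
Qed.

Let cvg_F : F x @[x --> +oo] --> (0 : R).
Proof.
rewrite -(mulr0 (- s ^+ 2)); apply: cvgM; first exact: cvg_cst.
(* With [y = x^2 / (2 s^2)], the inequality [exp (- y) <= 1 / y] bounds [x * p x] by the peak times
   [x / y = 2 s^2 / x]. *)
apply: (@squeeze_cvgr _ _ _ _ (fun=> 0)
  (fun x => (normal_peak s * (s ^+ 2 *+ 2)) * x^-1)).
- near=> x; have x0 : 0 < x by near: x; exact: nbhs_pinfty_gt.
  rewrite mulr_ge0 ?normal_pdf_ge0 ?(ltW x0)//=.
  rewrite normal_pdfE ?gt_eqF// /normal_fun subr0 mulrCA -!mulrA.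
  rewrite ler_wpM2l ?normal_peak_ge0// mulNr expRN.
  have s2 : 0 < s ^+ 2 *+ 2 by rewrite mulrn_wgt0// exprn_gt0.
  set y := x ^+ 2 / _.
  have y0 : 0 < y by rewrite divr_gt0// exprn_gt0.
  have -> : s ^+ 2 *+ 2 / x = x / y.
    by rewrite /y; field; rewrite !gt_eqF.
  rewrite ler_pM2l// lef_pV2 ?posrE ?expR_gt0//.
  by apply: le_trans (expR_ge1Dx y); rewrite lerDr.
- exact: cvg_cst.
- rewrite -(mulr0 (normal_peak s * (s ^+ 2 *+ 2))).
  apply: cvgM; first exact: cvg_cst.
  apply/gtr0_cvgV0; last exact: cvg_id.
  exact: nbhs_pinfty_gt.
Unshelve. all: by end_near. Qed.

(** Integration by parts in disguise. Cutting at [s], where [f] changes sign, keeps every integrand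
    nonnegative, so the sums can be rearranged in the extended reals before anything is known to be
    finite. *)
Lemma integral_sqr_normal_pdf0y :
  (\int[mu]_(x in `[0%R, +oo[) (x ^+ 2 * p x)%:E =
   \int[mu]_(x in `[0%R, +oo[) (s ^+ 2 * p x)%:E)%E.
Proof.
have mp : measurable_fun setT p by exact: measurable_normal_pdf.
have m2p (D : set R) : measurable_fun D (fun x : R => (x ^+ 2 * p x)%:E).
  by apply/measurable_funTS/measurable_EFinP/measurable_funM.
have msp (D : set R) : measurable_fun D (fun x : R => (s ^+ 2 * p x)%:E).
  by apply/measurable_funTS/measurable_EFinP/measurable_funM.
have mf (D : set R) : measurable_fun D (fun x : R => (f x)%:E).
  apply/measurable_funTS/measurable_EFinP/measurable_funM => //.
  exact: measurable_funB.
have mNf (D : set R) : measurable_fun D (fun x : R => (- f x)%:E).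
  by apply/measurable_EFinP/measurable_funN/measurable_EFinP; exact: mf.
have p0 x : 0 <= p x by exact: normal_pdf_ge0.
have split_s (h : R -> R) : (forall x : R, 0 <= h x) ->
    (forall D : set R, measurable_fun D (EFin \o h)) ->
    (\int[mu]_(x in `[0%R, +oo[) (h x)%:E = \int[mu]_(x in `[0%R, s]) (h x)%:E +
      \int[mu]_(x in `[s, +oo[) (h x)%:E)%E.
  move=> h0 mh.
  rewrite (@itv_bndbnd_setU _ _ _ (BRight s)) ?bnd_simp ?(ltW s0)//.
  rewrite ge0_integral_setU//=; [|exact: mh|by move=> x _; rewrite lee_fin|].
    by rewrite integral_itv_obnd_cbnd//; exact: mh.
  apply/disj_set2P; rewrite -subset0 => x [] /=; rewrite !in_itv/= andbT.
  by move=> /andP[_ xs]; rewrite ltNge xs.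
rewrite (split_s (fun x => x ^+ 2 * p x))//; last first.
  by move=> x; rewrite mulr_ge0 ?sqr_ge0.
rewrite (split_s (fun x => s ^+ 2 * p x))//; last first.
  by move=> x; rewrite mulr_ge0 ?sqr_ge0.
have F0 : F 0 = 0 by rewrite /F mul0r mulr0.
have int0s : (\int[mu]_(x in `[0%R, s]) (- f x)%:E = (- F s)%:E)%E.
  rewrite (@continuous_FTC2 _ _ (fun x => - F x)) //.
  - by rewrite F0 oppr0 sube0.
  - by apply: continuous_subspaceT => x; apply: cvgN; exact: continuous_f.
  - split.
    + by move=> x _; apply: derivableN; have [] := is_derive_F x.
    + apply/cvg_at_right_filter; apply: cvgN; exact: continuous_F.
    + apply/cvg_at_left_filter; apply: cvgN; exact: continuous_F.
  - move=> x _; rewrite derive1E; have dF := is_derive_F x.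
    by rewrite deriveN ?derive_val.
have intsy : (\int[mu]_(x in `[s, +oo[) (f x)%:E = (- F s)%:E)%E.
  rewrite (@ge0_continuous_FTC2y _ _ F _ 0) //.
  - by rewrite sub0e.
  - move=> x sx; rewrite mulr_ge0// subr_ge0 ler_pXn2r ?nnegrE ?(ltW s0)//.
    exact: le_trans (ltW s0) sx.
  - by apply: continuous_subspaceT => x; exact: continuous_f.
  - by move=> x _; have [] := is_derive_F x.
  - by apply/cvg_at_right_filter; exact: continuous_F.
  - move=> x _; rewrite derive1E; have dF := is_derive_F x.
    by rewrite derive_val.
have E1 : (\int[mu]_(x in `[0%R, s]) (s ^+ 2 * p x)%:E =
    \int[mu]_(x in `[0%R, s]) (x ^+ 2 * p x)%:E + (- F s)%:E)%E.
  rewrite -int0s -ge0_integralD//=.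
  - by apply: eq_integral => x _; rewrite -EFinD /f; congr EFin; ring.
  - by move=> x _; rewrite lee_fin mulr_ge0 ?sqr_ge0.
  - exact: m2p.
  - move=> x; rewrite in_itv/= => /andP[x0 xs].
    rewrite lee_fin -mulNr mulr_ge0// opprB subr_ge0.
    by rewrite ler_pXn2r// nnegrE (ltW s0).
  - exact: mNf.
have E2 : (\int[mu]_(x in `[s, +oo[) (x ^+ 2 * p x)%:E =
    \int[mu]_(x in `[s, +oo[) (s ^+ 2 * p x)%:E + (- F s)%:E)%E.
  rewrite -intsy -ge0_integralD//=.
  - by apply: eq_integral => x _; rewrite -EFinD /f; congr EFin; ring.
  - by move=> x _; rewrite lee_fin mulr_ge0 ?sqr_ge0.
  - exact: msp.
  - move=> x; rewrite in_itv/= andbT => sx.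
    rewrite lee_fin mulr_ge0// subr_ge0 ler_pXn2r ?nnegrE ?(ltW s0)//.
    exact: le_trans (ltW s0) sx.
  - exact: mf.
(* Both sides are now the integral of [x^2 p] over [[0, s]], plus that of [s^2 p] over [[s, +oo[],
   plus [- F s]. *)
by rewrite E1 E2 addeA addeAC.
Qed.

(** Both [x^2 p] and [s^2 p] are even, so their equality on the half-line extends to the whole line,
    where [p] has mass 1. *)
Lemma integral_sqr_normal_pdf0 :
  (\int[mu]_x (x ^+ 2 * p x)%:E = (s ^+ 2)%:E)%E.
Proof.
have p0 x : 0 <= p x by exact: normal_pdf_ge0.
have cp : continuous p by apply: continuous_normal_pdf; rewrite gt_eqF.
have set0y : [set x : R | 0 <= x] = `[0, +oo[%classic.
  by apply/seteqP; split => x/=; rewrite in_itv/= andbT.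
rewrite ge0_symfun_integralT.
- rewrite set0y integral_sqr_normal_pdf0y -set0y -ge0_symfun_integralT.
  + under eq_integral do rewrite EFinM.
    rewrite ge0_integralZl ?integral_normal_pdf ?mule1//.
    * by apply/measurable_EFinP; exact: measurable_normal_pdf.
    * by move=> x _; rewrite lee_fin.
    * by rewrite lee_fin sqr_ge0.
  + by move=> x; rewrite mulr_ge0 ?sqr_ge0.
  + by move=> x; apply: cvgM; [exact: cvg_cst|exact: cp].
  + by move=> x /=; rewrite normal_pdf0N.
- by move=> x; rewrite mulr_ge0 ?sqr_ge0.
- exact: continuous_sqr_pdf.
- by move=> x /=; rewrite normal_pdf0N sqrrN.
Qed.

(** Encodes the symmetry of the density with nonnegative integrands only; the vanishing of the
    Gaussian mean is drawn from it. *)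
Lemma integral_abs_normal_pdf0 :
  (\int[mu]_x (`|x| * p x)%:E = 2%:E * \int[mu]_x (Num.max x 0 * p x)%:E)%E.
Proof.
have cp : continuous p by apply: continuous_normal_pdf; rewrite gt_eqF.
rewrite ge0_symfun_integralT.
- congr (_ * _)%E; rewrite integral_mkcond/=; apply: eq_integral => x _.
  rewrite patchE; case: ifPn => [|]; rewrite ?notin_setE ?inE/=;
    [move=> x0|move=> /negP].
    by rewrite ger0_norm// max_l.
  by rewrite -ltNge => x0; rewrite max_r ?mul0r// ltW.
- by move=> x; rewrite mulr_ge0 ?normal_pdf_ge0.
- by move=> x; apply: cvgM; [exact: norm_continuous|exact: cp].
- by move=> x /=; rewrite normal_pdf0N normrN.
Qed.

End normal_moments.

(** * Square integrability, mean and variance of a Gaussian variable *)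

Section gaussian.
Context d (Omega : measurableType d) (R : realType) (P : probability Omega R).
Variables (Z : {mfun Omega >-> R}) (s : R).
Hypotheses (s0 : 0 < s) (gZ : gaussian P Z 0 s).

Lemma ge0_integral_gaussian (f : R -> R) :
  (forall x, 0 <= f x) -> measurable_fun setT f ->
  (\int[P]_w (f (Z w))%:E =
   \int[@lebesgue_measure R]_x (f x * normal_pdf 0 s x)%:E)%E.
Proof.
move=> f0 mf.
(* [normal_prob] is a measure on [measurableTypeR R], whose display is not the
   one of [R]. *)
have mZ : @measurable_fun _ _ Omega (measurableTypeR R) setT Z.
  exact: (measurable_funP Z).
pose Z' : {mfun Omega >-> measurableTypeR R} :=
  @mfun_Sub _ _ Omega (measurableTypeR R) Z (mem_set mZ).
have mEf : @measurable_fun _ _ (measurableTypeR R) _ setT (EFin \o f).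
  exact/measurable_EFinP.
transitivity (\int[distribution P Z']_y (EFin \o f) y)%E.
  by rewrite ge0_integral_distribution// => y; rewrite lee_fin.
rewrite (@eq_measure_integral _ _ _ _ (normal_prob 0 s)); last first.
  by move=> A mA _; exact: gZ.
by rewrite ge0_integral_normal_prob// => x; rewrite lee_fin.
Qed.

Lemma gaussian_Lfun2 : (Z : Omega -> R) \in Lfun P 2%:E.
Proof.
apply: Lfun2P => //; rewrite (@ge0_integral_gaussian (fun x => x ^+ 2))//.
  by rewrite integral_sqr_normal_pdf0 ?ltry.
by move=> x; exact: sqr_ge0.
Qed.

Lemma gaussian_mean : ip P Z (fun=> 1) = 0.
Proof.
have Z2 := gaussian_Lfun2.
have iZ : P.-integrable setT (EFin \o Z) by apply/Lfun1_integrable/Lfun2_Lfun1.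
have inZ : P.-integrable setT (EFin \o (fun w => `|Z w|)).
  exact: (integrable_abse iZ).
have iDZ : P.-integrable setT (EFin \o (fun w => Z w + `|Z w|)).
  exact: (integrableD measurableT iZ inZ).
have maxE x : Num.max x 0 = 2^-1 * (x + `|x|) :> R.
  by case: (leP 0 x) => x0; [rewrite ger0_norm//|rewrite ltr0_norm//]; field.
(* By symmetry of the law, [E |Z| = 2 E max(Z, 0) = E Z + E |Z|]. *)
have : (\int[P]_w (`|Z w|)%:E = 2%:E * \int[P]_w (Num.max (Z w) 0)%:E)%E.
  rewrite (@ge0_integral_gaussian (fun x => `|x|))//.
  rewrite (@ge0_integral_gaussian (fun x => Num.max x 0))//.
  - exact: integral_abs_normal_pdf0.
  - by move=> x; rewrite le_max lexx orbT.
  - by apply: measurable_maxr => //; exact: measurable_cst.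
have -> : (\int[P]_w (Num.max (Z w) 0)%:E =
    2^-1%:E * (\int[P]_w (Z w)%:E + \int[P]_w (`|Z w|)%:E))%E.
  rewrite -integralD// -integralZl//.
  by apply: eq_integral => w _; rewrite maxE EFinM.
rewrite muleA -EFinM divff// mul1e.
have : (\int[P]_w (Z w)%:E)%E \is a fin_num.
  exact: (integrable_fin_num measurableT iZ).
have : (\int[P]_w (`|Z w|)%:E)%E \is a fin_num.
  exact: (integrable_fin_num measurableT inZ).
rewrite /ip; under eq_Rintegral do rewrite mulr1.
rewrite /Rintegral.
case: (\int[P]_w (Z w)%:E)%E => // a.
case: (\int[P]_w (`|Z w|)%:E)%E => // b _ _ [].
by rewrite /=; lra.
Qed.

Lemma gaussian_var : ip P Z Z = s ^+ 2.
Proof.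
apply: EFin_inj; rewrite ipE; last exact: gaussian_Lfun2.
rewrite (@ge0_integral_gaussian (fun x => x ^+ 2)) ?integral_sqr_normal_pdf0//.
by move=> x; exact: sqr_ge0.
Qed.

End gaussian.

(** * Independent variables: the expectation of a product *)

Section independence.
Context d (Omega : measurableType d) (R : realType) (P : probability Omega R).
Variables X Y : {mfun Omega >-> R}.
Hypotheses (X2 : (X : Omega -> R) \in Lfun P 2%:E)
           (Y2 : (Y : Omega -> R) \in Lfun P 2%:E).
Hypothesis XY : forall A B : set R, measurable A -> measurable B ->
  (P (X @^-1` A `&` Y @^-1` B) = P (X @^-1` A) * P (Y @^-1` B))%E.

(** The joint law agrees with the product of the marginal laws on rectangles, hence everywhere, and
    Fubini factors the integral of the product of coordinates. *)
Lemma ip_independent : ip P X Y = ip P X (fun=> 1) * ip P Y (fun=> 1).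
Proof.
have mXY : measurable_fun setT (fun w => (X w, Y w)).
  exact: measurable_fun_pair.
pose XYm : {mfun Omega >-> (R * R)%type} := mfun_Sub (mem_set mXY).
pose m1 := distribution P X; pose m2 := distribution P Y.
have mE A : measurable A -> (m1 \x m2)%E A = distribution P XYm A.
  apply: product_measure_unique => A1 A2 mA1 mA2.
  by rewrite -XY.
have iX : P.-integrable setT (EFin \o X) by apply/Lfun1_integrable/Lfun2_Lfun1.
have iY : P.-integrable setT (EFin \o Y) by apply/Lfun1_integrable/Lfun2_Lfun1.
have iXY := Lfun2_mulr_integrable X2 Y2.
pose h (z : R * R) := (z.1 * z.2)%:E.
have mh : measurable_fun setT h.
  apply/measurable_EFinP/measurable_funM; first exact: measurable_fst.
  exact: measurable_snd.
have eh (k : R * R -> \bar R) :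
    (\int[m1 \x m2]_z k z = \int[distribution P XYm]_z k z)%E.
  by apply: eq_measure_integral => A mA _; exact: mE.
have ih : (m1 \x m2)%E.-integrable setT h.
  apply/integrableP; split => //; rewrite eh.
  rewrite ge0_integral_distribution//; last first.
    exact: measurableT_comp.
  by case/integrableP : iXY.
have iY' : m2.-integrable setT (EFin : R -> \bar R).
  apply/integrableP; split; first exact: EFin_measurable.
  rewrite ge0_integral_distribution//; last exact: measurableT_comp.
  by case/integrableP : iY.
have iX' : m1.-integrable setT (EFin : R -> \bar R).
  apply/integrableP; split; first exact: EFin_measurable.
  rewrite ge0_integral_distribution//; last exact: measurableT_comp.
  by case/integrableP : iX.
have EX : (\int[m1]_x x%:E = \int[P]_w (X w)%:E)%E.
  by rewrite integral_distribution.
have EY : (\int[m2]_x x%:E = \int[P]_w (Y w)%:E)%E.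
  by rewrite integral_distribution.
have fX : (\int[P]_w (X w)%:E)%E \is a fin_num.
  exact: (integrable_fin_num measurableT iX).
have fY : (\int[P]_w (Y w)%:E)%E \is a fin_num.
  exact: (integrable_fin_num measurableT iY).
have E : (\int[P]_w (X w * Y w)%:E = \int[P]_w (X w)%:E * \int[P]_w (Y w)%:E)%E.
  transitivity (\int[distribution P XYm]_z h z)%E.
    by rewrite integral_distribution.
  rewrite -eh -integral12_prod_meas1//.
  transitivity (\int[m1]_x (x%:E * \int[P]_w (Y w)%:E))%E.
    apply: eq_integral => x _; rewrite -EY -integralZl//.
  by rewrite -(fineK fY) integralZr// EX.
rewrite /ip; under [X in X * _]eq_Rintegral do rewrite mulr1.
under [X in _ * X]eq_Rintegral do rewrite mulr1.
by rewrite /Rintegral E fineM.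
Qed.

End independence.

(** * Sequence model *)

(** Links [dot2] on [l2 R], an integral against the counting measure, to ordinary series:
    integrability there is absolute summability, so the partial sums converge. *)
Lemma integrable_counting_series_cvg (R : realType) (a : nat -> R) :
  (@counting nat R).-integrable setT (EFin \o a) ->
  series a @ \oo --> \int[@counting nat R]_k a k.
Proof.
move=> /integrableP[_]; rewrite ge0_integral_count// => sa.
have suma : summable setT (EFin \o a).
  by rewrite /summable -nneseries_esumT.
have ca : cvgn (series a).
  apply: normed_cvg.
  have := @summable_cvg R xpredT (fun k => `|(a k)%:E|)%E.
  apply => //; rewrite /summable -(@nneseries_esum _ _ xpredT)//.
  by under eq_eseriesr do rewrite abse_id.
rewrite /Rintegral integral_count//.
have -> : (\sum_(k <oo) (EFin \o a) k = (limn (series a))%:E)%E.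
  rewrite -EFin_lim//; congr (lim (_ @ \oo)); apply/funext => m.
  by rewrite /= /series/= sumEFin.
exact: ca.
Qed.

(** * From almost sure to mean-square convergence *)

Section L2_fatou.
Context d (T : measurableType d) (R : realType) (P : {measure set T -> \bar R}).

(** Fatou's lemma in [M], with [N] fixed, bounds the integral of [(D - S_ N)^2] by the limit [r N]
    of the integrals of [(S_ M - S_ N)^2]. *)
Lemma ae_cvg_L2_cvg (S_ : nat -> T -> R) (D : T -> R) (r : nat -> R) :
  (forall j, S_ j \in Lfun P 2%:E) -> measurable_fun setT D ->
  {ae P, forall w, S_ j w @[j --> \oo] --> D w} ->
  (forall N, ip P (S_ M \- S_ N) (S_ M \- S_ N) @[M --> \oo] --> r N) ->
  r N @[N --> \oo] --> 0 ->
  D \in Lfun P 2%:E /\ L2_cvg P S_ D.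
Proof.
move=> S2 mD SD Sr r0.
have mS j : measurable_fun setT (S_ j).
  by have := S2 j; rewrite inE => /andP[/[!inE]].
have mSS M N : measurable_fun setT (fun w => ((S_ M w - S_ N w) ^+ 2)%:E).
  by apply/measurable_EFinP/measurable_funX/measurable_funB.
have mDS N : measurable_fun setT (fun w => ((D w - S_ N w) ^+ 2)%:E).
  by apply/measurable_EFinP/measurable_funX/measurable_funB.
have DSle N : (\int[P]_w ((D w - S_ N w) ^+ 2)%:E <= (r N)%:E)%E.
  have -> : (\int[P]_w ((D w - S_ N w) ^+ 2)%:E =
      \int[P]_w limn_einf (fun M => ((S_ M w - S_ N w) ^+ 2)%:E))%E.
    apply: ge0_ae_eq_integral => //.
    (* The lower limit is the opposite of the upper limit of the opposites, whose measurability is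
       available. *)
    - apply: (@measurableT_comp _ _ _ _ _ _ -%E _ (fun w =>
        limn_esup (fun M => - ((S_ M w - S_ N w) ^+ 2)%:E)%E)) => //.
      apply: measurable_fun_limn_esup => M.
      exact: (measurableT_comp _ (mSS M N)).
    - by move=> w _; rewrite lee_fin sqr_ge0.
    - move=> w _; rewrite limn_einf_lim; apply: lime_ge.
        exact: is_cvg_einfs.
      apply: nearW => M; apply: le_ereal_inf_tmp => _ [k _ <-].
      by rewrite lee_fin sqr_ge0.
    - apply: filterS SD => w Sw _; apply/esym.
      have : (fun M => ((S_ M w - S_ N w) ^+ 2)%:E) @ \oo -->
          ((D w - S_ N w) ^+ 2)%:E.
        apply/cvg_EFin; first exact: nearW.
        apply: (cvg_comp (fun M => S_ M w - S_ N w) (fun x => x ^+ 2));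
          last exact: sqr_continuous.
        by apply: cvgB => //; exact: cvg_cst.
      by move=> /cvg_limn_einf_sup[].
  apply: le_trans (fatou _ _ _ _) _ => //.
  - by move=> M w _; rewrite lee_fin sqr_ge0.
  - have : (fun M => \int[P]_w ((S_ M w - S_ N w) ^+ 2)%:E)%E @ \oo -->
        (r N)%:E.
      under eq_fun do rewrite -(ipE (Lfun2B (S2 _) (S2 _))).
      by apply/cvg_EFin; [exact: nearW|exact: Sr].
    by move=> /cvg_limn_einf_sup[-> _].
have D2 : D \in Lfun P 2%:E.
  have DS2 : (D \- S_ 0%N) \in Lfun P 2%:E.
    apply: Lfun2P; first exact: measurable_funB.
    by apply: le_lt_trans (DSle 0%N) _; rewrite ltry.
  have -> : D = (D \- S_ 0%N) \+ S_ 0%N by apply/funext => w /=; rewrite subrK.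
  exact: Lfun2D.
split => //; rewrite /L2_cvg.
have ipDS N : ip P (S_ N \- D) (S_ N \- D) <= r N.
  rewrite -lee_fin ipE; last exact: Lfun2B.
  apply: le_trans (DSle N); rewrite le_eqVlt; apply/orP; left; apply/eqP.
  by apply: eq_integral => w _ /=; rewrite -sqrrN opprB.
apply: (squeeze_cvgr (f := fun=> 0) (h := r)) => //; last exact: cvg_cst.
by apply: nearW => N; rewrite ip_ge0 ipDS.
Qed.

End L2_fatou.

(** * Mean and variance of the series of [u i * Y i] *)

Section sequence_model.
Context d (Omega : measurableType d) (R : realType) (P : probability Omega R).

Lemma mutually_independent_pair (I : eqType) (Z : I -> Omega -> R) i j :
  mutually_independent P Z -> i != j ->
  forall A B : set R, measurable A -> measurable B ->
  (P (Z i @^-1` A `&` Z j @^-1` B) = P (Z i @^-1` A) * P (Z j @^-1` B))%E.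
Proof.
move=> indZ ij A B mA mB; pose C k := if k == i then A else B.
have := indZ [:: i; j] C; rewrite /= inE ij => /(_ isT).
rewrite !big_cons big_nil mule1 /C eqxx eq_sym (negbTE ij) => <-; last first.
  by move=> k; case: ifP.
congr (P _); apply/seteqP; split=> [w [Zi Zj] k /=|w /= H].
  by rewrite !inE => /orP[]/eqP->; rewrite ?eqxx// eq_sym (negbTE ij).
split.
  by have := H i; rewrite /= inE eqxx /= => /(_ isT).
by have := H j; rewrite /= !inE eqxx orbT eq_sym (negbTE ij) => /(_ isT).
Qed.

Lemma L2_cvg_affine_moments (S_ : nat -> Omega -> R) (D Z : Omega -> R)
    (m v : R) :
  (forall j, S_ j \in Lfun P 2%:E) -> D \in Lfun P 2%:E -> L2_cvg P S_ D ->
  (forall j, ip P (S_ j) (fun=> 1) = 0) ->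
  ip P (S_ j) (S_ j) @[j --> \oo] --> v ->
  (forall w, Z w = m + D w) ->
  [/\ Z \in Lfun P 2%:E, ('E_P[Z])%E = m%:E & 'V_P[Z] = v%:E].
Proof.
move=> S2 D2 SD S1 Sv ZE.
have ZE' : Z = cst m \+ D by apply/funext => w /=; exact: ZE.
have [ED VD] : ('E_P[D])%E = 0%:E /\ 'V_P[D] = v%:E.
  apply: (L2_cvg_moments S2 D2 SD).
    by under eq_fun do rewrite S1; exact: cvg_cst.
  by rewrite expr0n/= add0r.
split.
- by rewrite ZE'; apply: Lfun2D => //; exact: Lfun2_cst.
- rewrite ZE' expectationD; [|exact: Lfun_cst|exact: Lfun2_Lfun1].
  by rewrite expectation_cst ED adde0.
- by rewrite ZE' varianceD_cst_l.
Qed.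

Lemma ip_sum_mean (xi : nat -> Omega -> R) (c : nat -> R) m :
  (forall k, xi k \in Lfun P 2%:E) -> (forall k, ip P (xi k) (fun=> 1) = 0) ->
  ip P (fun w => \sum_(k < m) c k * xi k w) (fun=> 1) = 0.
Proof.
move=> xi2 xi1; rewrite ip_suml//; last exact: Lfun2_cst.
by rewrite big1// => k _; rewrite xi1 mulr0.
Qed.

(** The series of [u i * h i] converges by itself, so [D = Z - dot2 u h] is the almost sure limit of
    the centred sums [S_ N]; orthogonality of the noise makes these Cauchy in mean square. *)
Lemma gaussian_sequence_series (n : R) (h u : l2 R)
    (Y : nat -> {mfun Omega >-> R}) (Z : {mfun Omega >-> R}) : 0 < n ->
  gaussian_sequence P n h Y -> is_series_sum P Y u Z ->
  [/\ (Z : Omega -> R) \in Lfun P 2%:E, ('E_P[Z])%E = (dot2 u h)%:E &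
      'V_P[Z] = (n^-1 * dot2 u u)%:E].
Proof.
move=> n0 [xi [ind gxi YE]] sumZ.
pose kap := (Num.sqrt n)^-1.
have kap2 : kap ^+ 2 = n^-1 by rewrite exprVn sqr_sqrtr// ltW.
have xi2 k : (xi k : Omega -> R) \in Lfun P 2%:E by exact: (gaussian_Lfun2 ltr01).
have xi1 k : ip P (xi k) (fun=> 1) = 0 by exact: (gaussian_mean ltr01).
have xiv k : ip P (xi k) (xi k) = 1.
  by rewrite (gaussian_var ltr01)// expr1n.
have xi0 k l : k != l -> ip P (xi k) (xi l) = 0.
  move=> kl; rewrite ip_independent// ?xi1 ?mul0r//.
  exact: mutually_independent_pair ind kl.
have cvg2 (g : l2 R) : series (fun i => u i * g i) @ \oo --> dot2 u g.
  apply: integrable_counting_series_cvg.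
  by apply: Lfun2_mulr_integrable; exact: LfunP.
pose q N := \sum_(k < N) u k ^+ 2.
have qE N : series (fun i => u i * u i) N = q N.
  by rewrite /series /= big_mkord; apply: eq_bigr => i _; rewrite expr2.
have cq : q @ \oo --> dot2 u u.
  by rewrite -(funext qE); exact: cvg2.
pose c k := kap * u k.
pose S_ N (w : Omega) := \sum_(k < N) c k * xi k w.
pose D w := Z w - dot2 u h.
have S2 N : S_ N \in Lfun P 2%:E by exact: (Lfun2_sum xi2).
have mD : measurable_fun setT D.
  by apply: measurable_funB => //; exact: measurable_cst.
have SY N w :
    S_ N w = series (fun i => u i * Y i w) N - series (fun i => u i * h i) N.
  rewrite /series/= !big_mkord -sumrB; apply: eq_bigr => k _.
  by rewrite YE /c -/kap; ring.
have SD : {ae P, forall w, S_ j w @[j --> \oo] --> D w}.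
  apply: filterS sumZ => w Zw.
  rewrite (funext (SY ^~ w)) /D.
  exact: cvgB Zw (cvg2 h).
have ipS M N : (N <= M)%N ->
    ip P (S_ M \- S_ N) (S_ M \- S_ N) = n^-1 * (q M - q N).
  (* Zeroing the coefficients below [N] turns the difference into a sum over [k < M], to which
     [ip_sum_orthogonal] applies. *)
  move=> NM; pose c' k := if (k < N)%N then 0 else c k.
  have -> : S_ M \- S_ N = (fun w => \sum_(k < M) c' k * xi k w).
    apply/funext => w /=.
    rewrite /S_ (big_ord_widen _ (fun k => c k * xi k w) NM).
    rewrite (bigID (fun k : 'I_M => (k < N)%N)) /= addrAC subrr add0r.
    rewrite [RHS](bigID (fun k : 'I_M => (k < N)%N)) /=.
    rewrite [X in _ = X + _]big1 ?add0r.
      by apply: eq_bigr => k; rewrite /c' => /negbTE ->.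
    by move=> k kN; rewrite /c' kN mul0r.
  rewrite (ip_sum_orthogonal xi2 c' M xi0 xiv).
  rewrite /q (big_ord_widen _ (fun k => u k ^+ 2) NM).
  rewrite [in RHS](bigID (fun k : 'I_M => (k < N)%N)) /= addrAC subrr add0r.
  rewrite (bigID (fun k : 'I_M => (k < N)%N)) /=.
  rewrite [X in X + _ = _]big1 ?add0r.
    rewrite mulr_sumr; apply: eq_bigr => k; rewrite /c' => /negbTE ->.
    by rewrite /c exprMn kap2 mulr1.
  by move=> k kN; rewrite /c' kN expr0n mul0r.
have [D2 SDL2] : D \in Lfun P 2%:E /\ L2_cvg P S_ D.
  (* The bound is [n^-1] times the tail beyond [N] of the series of squares of [u]. *)
  apply: (@ae_cvg_L2_cvg _ _ _ P S_ D (fun N => n^-1 * (dot2 u u - q N))) => //.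
    move=> N; apply: (@cvg_trans _ ((fun M => n^-1 * (q M - q N)) @ \oo)).
      apply: near_eq_cvg; near=> M; apply/esym/ipS.
      by near: M; exact: nbhs_infty_ge.
    by apply: cvgM; [exact: cvg_cst|apply: cvgB => //; exact: cvg_cst].
  rewrite -(mulr0 n^-1) -(subrr (dot2 u u)).
  by apply: cvgM; [exact: cvg_cst|apply: cvgB => //; exact: cvg_cst].
apply: (L2_cvg_affine_moments S2 D2 SDL2).
- by move=> N; exact: (ip_sum_mean _ _ xi2 xi1).
- have SE N : ip P (S_ N) (S_ N) = n^-1 * q N.
    rewrite (ip_sum_orthogonal xi2 c N xi0 xiv) /q mulr_sumr.
    by apply: eq_bigr => k _; rewrite /c exprMn kap2 mulr1.
  by rewrite (funext SE); apply: cvgM; [exact: cvg_cst|exact: cq].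
- by move=> w; rewrite /D addrC subrK.
Unshelve. all: by end_near. Qed.

End sequence_model.

(** * White noise model *)

Section step_functions.
Variables (R : realType) (I : interval R).
Local Notation mu := (itv_measure R I).

Lemma itv_oc_sub (a b : R) : a \in I -> b \in I -> `]a, b] `<=` [set` I].
Proof.
move=> aI bI x /=; rewrite in_itv/= => /andP[ax xb].
by apply: (@interval_is_interval _ I a b) => //; rewrite (ltW ax) xb.
Qed.

Lemma itv_measure_sub (A : set R) : A `<=` [set` I] ->
  mu A = lebesgue_measure A.
Proof. by move=> AI; rewrite /mrestr/= setIidl. Qed.

Lemma itv_measure_oc (a b : R) : a \in I -> b \in I -> a <= b ->
  mu `]a, b] = (b - a)%:E.
Proof.
move=> aI bI ab; rewrite itv_measure_sub; last exact: itv_oc_sub.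
rewrite lebesgue_measure_itv/= lte_fin; case: ltP => // ba.
by rewrite (@le_anti _ _ a b) ?ab ?ba// subrr.
Qed.

Lemma integral_indic_sqr (a b : R) : a \in I -> b \in I -> a <= b ->
  (\int[mu]_x (\1_(`]a, b]) x ^+ 2)%:E = (b - a)%:E)%E.
Proof.
move=> aI bI ab.
under eq_integral do rewrite indicE -natrX -mulnn mulnb andbb -indicE.
rewrite integral_indic// setIT. exact: itv_measure_oc.
Qed.

Lemma indic_Lfun2 (a b : R) : a \in I -> b \in I -> a <= b ->
  (\1_(`]a, b]) : R -> R) \in Lfun mu 2%:E.
Proof.
move=> aI bI ab; apply: Lfun2P; first exact: measurable_indic.
by rewrite integral_indic_sqr ?ltry.
Qed.

Lemma ip_indic (a b : R) : a \in I -> b \in I -> a <= b ->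
  ip mu (\1_(`]a, b])) (\1_(`]a, b])) = b - a.
Proof.
move=> aI bI ab; apply: EFin_inj; rewrite ipE; last exact: indic_Lfun2.
exact: integral_indic_sqr.
Qed.

Lemma ip_indic_disjoint (A B : set R) : A `&` B = set0 ->
  ip mu (\1_A) (\1_B) = 0.
Proof.
move=> AB; rewrite /ip (@eq_Rintegral _ _ _ _ _ (cst 0)) ?Rintegral_cst ?mul0r//.
move=> x _; rewrite !indicE -natrM mulnb -in_setI AB.
by rewrite in_set0.
Qed.

(** Cells are half-open in [step_fun], for disjointness, but closed in [white_noise]. The left
    endpoint is null, and the cell lies in [I], where [mu] agrees with Lebesgue measure. *)
Lemma ip_indicl (a b : R) (h : L2_itv R I) : a \in I -> b \in I ->
  ip mu (\1_(`]a, b])) h = \int[lebesgue_measure]_(x in `[a, b]) h x.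
Proof.
move=> aI bI; rewrite /ip.
transitivity (\int[mu]_(x in `]a, b]) h x).
  rewrite [RHS]Rintegral_mkcond; apply: eq_Rintegral => x _.
  by rewrite patchE indicE; case: ifP; rewrite ?mul1r ?mul0r.
rewrite /Rintegral (@eq_measure_integral _ _ _ _ lebesgue_measure); last first.
  move=> A mA Aab; apply: itv_measure_sub.
  exact: subset_trans Aab (itv_oc_sub aI bI).
rewrite integral_itv_obnd_cbnd//.
apply/measurable_EFinP; apply: measurable_funTS; exact: (measurable_funP h).
Qed.

End step_functions.

(** * First two moments of Brownian increments along a grid *)

Section brownian_increments.
Context d (Omega : measurableType d) (R : realType) (P : probability Omega R).
Variables (I : interval R) (W : R -> {mfun Omega >-> R}) (t : nat -> R).
Hypotheses (bW : brownian_motion P I W) (gt : grid I t).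

Definition increment (k : nat) (w : Omega) : R := W (t k.+1) w - W (t k) w.

(** [increment k] bundled with its measurability, as the Gaussian and independence lemmas expect. *)
Let dW k : {mfun Omega >-> R} := (W (t k.+1) - W (t k))%R.

Let tI k : t k \in I. Proof. by case: gt. Qed.
Let tS k : t k <= t k.+1. Proof. by case: gt => _; apply. Qed.

Let gaussian_increment k : t k < t k.+1 ->
  gaussian P (dW k) 0 (Num.sqrt (t k.+1 - t k)).
Proof. by move=> tk; case: bW => gW _ _; exact: gW. Qed.

Let sqrt_gt0 k : t k < t k.+1 -> 0 < Num.sqrt (t k.+1 - t k).
Proof. by move=> tk; rewrite sqrtr_gt0 subr_gt0. Qed.

(** Zero is kept as a multiple of [increment k] so that [ipZl] can pull out the factor 0. *)
Let increment0 k : t k = t k.+1 -> increment k = (fun w => 0 * increment k w).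
Proof. by move=> tk; apply/funext => w; rewrite mul0r /increment tk subrr. Qed.

(* Consecutive grid points may coincide, where [gaussian _ 0] is not a point mass
   and gives no information. *)
Lemma increment_Lfun2 k : increment k \in Lfun P 2%:E.
Proof.
have := tS k; rewrite le_eqVlt => /orP[/eqP/increment0|tk]; last first.
  exact: (gaussian_Lfun2 (sqrt_gt0 tk) (gaussian_increment tk)).
suff -> : (fun w => 0 * increment k w) = (fun=> 0) by move->; exact: Lfun2_cst.
by apply/funext => w; rewrite mul0r.
Qed.

Lemma increment_mean k : ip P (increment k) (fun=> 1) = 0.
Proof.
have := tS k; rewrite le_eqVlt => /orP[/eqP/increment0->|tk]; last first.
  exact: (gaussian_mean (sqrt_gt0 tk) (gaussian_increment tk)).
by rewrite ipZl ?mul0r//; [exact: increment_Lfun2|exact: Lfun2_cst].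
Qed.

Lemma increment_var k : ip P (increment k) (increment k) = t k.+1 - t k.
Proof.
have := tS k; rewrite le_eqVlt => /orP[/eqP tk|tk]; last first.
  rewrite -[RHS]sqr_sqrtr ?subr_ge0//.
  exact: (gaussian_var (sqrt_gt0 tk) (gaussian_increment tk)).
rewrite [X in ip P X _](increment0 tk) ipZl; [|exact: increment_Lfun2..].
by rewrite mul0r tk subrr.
Qed.

Lemma increment_orthogonal k l : k != l -> ip P (increment k) (increment l) = 0.
Proof.
move=> kl; have [_ /(_ t gt) indW _] := bW.
have : ip P (dW k) (dW l) = ip P (dW k) (fun=> 1) * ip P (dW l) (fun=> 1).
  apply: ip_independent; [exact: increment_Lfun2..|].
  exact: (mutually_independent_pair indW kl).
by move=> ->; rewrite [ip P (dW k) _]increment_mean mul0r.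
Qed.

End brownian_increments.

(** * Mean and variance of the stochastic integral *)

Section white_noise_model.
Context d (Omega : measurableType d) (R : realType) (P : probability Omega R).
Variable I : interval R.
Local Notation mu := (itv_measure R I).

Lemma step_fun_Lfun2 m c t : grid I t -> step_fun m c t \in Lfun mu 2%:E.
Proof.
move=> [tI tS].
have tk k : (\1_(`]t k, t k.+1]) : R -> R) \in Lfun mu 2%:E.
  by apply: indic_Lfun2 => //; exact: tS.
exact: (Lfun2_sum tk c m).
Qed.

(** Disjoint cells give orthogonal indicators of squared norm [t k.+1 - t k]: the same inner
    products as the Brownian increments, which is the Ito isometry on step functions. *)
Lemma ip_step_fun m c t : grid I t ->
  ip mu (step_fun m c t) (step_fun m c t) =
  \sum_(k < m) c k ^+ 2 * (t k.+1 - t k).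
Proof.
move=> [tI tS]; have tle k : t k <= t k.+1 by exact: tS.
have tk k : (\1_(`]t k, t k.+1]) : R -> R) \in Lfun mu 2%:E.
  exact: indic_Lfun2.
have H k l : (k < l)%N ->
    ip mu (\1_(`]t k, t k.+1])) (\1_(`]t l, t l.+1])) = 0.
  move=> kl; apply: ip_indic_disjoint; apply/seteqP; split => // x [] /=.
  rewrite !in_itv/= => /andP[_ xk] /andP[lx _].
  by have := le_lt_trans (le_trans xk (tS _ _ kl)) lx; rewrite ltxx.
have H0 k l : k != l ->
    ip mu (\1_(`]t k, t k.+1])) (\1_(`]t l, t l.+1])) = 0.
  by rewrite neq_ltn => /orP[/H//|/H]; rewrite ipC.
exact: (ip_sum_orthogonal tk c m H0
  (fun k => ip_indic (tI k) (tI k.+1) (tle k))).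
Qed.

Lemma ip_step_funl m c t (h : L2_itv R I) : grid I t ->
  ip mu (step_fun m c t) h =
  \sum_(k < m) c k * \int[lebesgue_measure]_(x in `[t k, t k.+1]) h x.
Proof.
move=> [tI tS]; have tle k : t k <= t k.+1 by exact: tS.
have tk k : (\1_(`]t k, t k.+1]) : R -> R) \in Lfun mu 2%:E.
  exact: indic_Lfun2.
rewrite (ip_suml tk c m (LfunP h)).
by apply: eq_bigr => k _; rewrite ip_indicl.
Qed.

(** For a step function [phi j], the integral is the constant [ip mu (phi j) h] plus centred noise
    of variance [n^-1] times the squared norm of [phi j]. Both quantities converge as [phi j] tends
    to [u], and [X_ j] tends to [Z] in mean square. *)
Lemma white_noise_stoch_integral (n : R) (h u : L2_itv R I)
    (Y : R -> {mfun Omega >-> R}) (Z : {mfun Omega >-> R}) : 0 < n ->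
  white_noise P I n h Y -> is_stoch_integral P I Y u Z ->
  [/\ (Z : Omega -> R) \in Lfun P 2%:E, ('E_P[Z])%E = (dot2 u h)%:E &
      'V_P[Z] = (n^-1 * dot2 u u)%:E].
Proof.
move=> n0 [W bW YW] [m [c [t [gt cu cZ]]]].
pose kap := (Num.sqrt n)^-1.
have kap2 : kap ^+ 2 = n^-1 by rewrite exprVn sqr_sqrtr// ltW.
pose phi j := step_fun (m j) (c j) (t j).
pose X_ j := step_integral Y (m j) (c j) (t j).
have phi2 j : phi j \in Lfun mu 2%:E by exact: step_fun_Lfun2.
have u2 : (u : R -> R) \in Lfun mu 2%:E by exact: LfunP.
have h2 : (h : R -> R) \in Lfun mu 2%:E by exact: LfunP.
have phiu : L2_cvg mu phi u.
  by have [] := @Lnorm2_cvg _ _ _ mu phi u phi2 (measurable_funP u) cu.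
pose kc j k := kap * c j k.
pose S_ j w := \sum_(k < m j) kc j k * increment W (t j) k w.
have dW2 j := increment_Lfun2 bW (gt j).
have dW1 j := increment_mean bW (gt j).
have S2 j : S_ j \in Lfun P 2%:E by exact: (Lfun2_sum (dW2 j) (kc j) (m j)).
have S1 j : ip P (S_ j) (fun=> 1) = 0.
  exact: (ip_sum_mean (kc j) (m j) (dW2 j) (dW1 j)).
have SS j : ip P (S_ j) (S_ j) = n^-1 * ip mu (phi j) (phi j).
  rewrite (ip_sum_orthogonal (dW2 j) (kc j) (m j)
    (increment_orthogonal bW (gt j)) (increment_var bW (gt j))).
  rewrite ip_step_fun// mulr_sumr; apply: eq_bigr => k _.
  rewrite /kc exprMn kap2; ring.
have XE j : X_ j = (fun=> ip mu (phi j) h) \+ S_ j.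
  apply/funext => w /=; rewrite ip_step_funl// -big_split/=.
  apply: eq_bigr => k _; have [tI tS] := gt j.
  by rewrite YW//; [rewrite /increment /kc -/kap; ring|exact: tS].
have X2 j : X_ j \in Lfun P 2%:E.
  by rewrite XE; apply: Lfun2D => //; exact: Lfun2_cst.
have ip1 (b : R) : ip P (fun=> b) (fun=> 1) = b.
  rewrite /ip Rintegral_cst//= probability_setT mulr1 mulr1//.
have X1 j : ip P (X_ j) (fun=> 1) = ip mu (phi j) h.
  by rewrite XE ipDl ?S1 ?addr0 ?ip1//; exact: Lfun2_cst.
have XX j :
    ip P (X_ j) (X_ j) = ip mu (phi j) h ^+ 2 + n^-1 * ip mu (phi j) (phi j).
  have c2 := Lfun2_cst P (ip mu (phi j) h).
  (* The cross term vanishes because a constant is orthogonal to centred noise. *)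
  have bS : ip P (fun=> ip mu (phi j) h) (S_ j) = 0.
    have -> : (fun=> ip mu (phi j) h) =
        (fun w : Omega => ip mu (phi j) h * (fun=> 1) w).
      by apply/funext => w; rewrite mulr1.
    by rewrite ipZl ?[ip P _ (S_ j)]ipC ?S1 ?mulr0//; exact: Lfun2_cst.
  rewrite XE ipDl//; last exact: Lfun2D.
  rewrite !(ipC _ _ (_ \+ S_ j)) !ipDl// [X in _ + (X + _)]bS SS.
  rewrite (ipC _ (S_ j)) bS addr0 add0r.
  rewrite [X in X + _ = _](_ : _ = ip mu (phi j) h ^+ 2)//.
  by rewrite /ip Rintegral_cst//= probability_setT mulr1.
have cm : ip mu (phi j) h @[j --> \oo] --> dot2 u h.
  exact: (ip_cvg phi2 u2 phiu h2).
have [Z2 XZ] : (Z : Omega -> R) \in Lfun P 2%:E /\ L2_cvg P X_ Z.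
  exact: (Lnorm2_cvg X2 (measurable_funP Z) cZ).
have [EZ VZ] :
    ('E_P[Z])%E = (dot2 u h)%:E /\ 'V_P[Z] = (n^-1 * dot2 u u)%:E.
  apply: (L2_cvg_moments X2 Z2 XZ); first by rewrite (funext X1).
  rewrite (funext XX); apply: cvgD.
    exact: (cvg_comp _ _ cm (@sqr_continuous R (dot2 u h))).
  by apply: cvgM; [exact: cvg_cst|exact: (ip_sqr_cvg phi2 u2 phiu)].
by split.
Qed.

End white_noise_model.

(** * Bias of the affine estimator *)

Section minimax_bias.
Context d (X : measurableType d) (R : realType) (mu : {measure set X -> \bar R}).
Variables (T : L2 mu -> R) (D F G : set (L2 mu)) (n V eps : R).
Implicit Types f g h : L2 mu.

Lemma dot2C f g : dot2 f g = dot2 g f.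
Proof. exact: ipC. Qed.

Lemma dot2Dl f g h : dot2 (f + g) h = dot2 f h + dot2 g h.
Proof. by apply: ipDl; exact: LfunP. Qed.

Lemma dot2Zl a f g : dot2 (a *: f) g = a * dot2 f g.
Proof. by apply: ipZl; exact: LfunP. Qed.

Lemma dot2Dr f g h : dot2 h (f + g) = dot2 h f + dot2 h g.
Proof. by rewrite dot2C dot2Dl !(dot2C h). Qed.

Lemma dot2Zr a f g : dot2 g (a *: f) = a * dot2 g f.
Proof. by rewrite dot2C dot2Zl (dot2C g). Qed.

Lemma dot2_sqrDZ b f g : dot2 (f + b *: g) (f + b *: g) =
  dot2 f f + 2 * b * dot2 f g + b ^+ 2 * dot2 g g.
Proof. by rewrite dot2Dl !dot2Dr !dot2Zl !dot2Zr (dot2C g f); ring. Qed.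

Lemma sqr_norm2 f : norm2 f ^+ 2 = dot2 f f.
Proof. by rewrite /norm2 Lnorm2_sqrt/= ?sqr_sqrtr ?ip_ge0//; exact: LfunP. Qed.

Lemma norm2_ge0 f : 0 <= norm2 f.
Proof. by rewrite fine_ge0// Lnorm_ge0. Qed.

Lemma convex_setP (A : set (L2 mu)) f g (t : R) : convex_set A ->
  A f -> A g -> 0 <= t <= 1 -> A (f + t *: (g - f)).
Proof.
move=> cA Af Ag t01.
have ti : Itv.spec (@Itv.num_sem R) (Itv.Real `[0%Z, 1%Z]) t.
  by rewrite /= /Itv.num_sem /= num_real in_itv/= t01.
(* The parameter weighs the first argument, hence [g] comes before [f]. *)
have := cA g f (Itv.mk ti) (mem_set Ag) (mem_set Af); rewrite inE.
congr A; rewrite /conv /= /unstable.onem scalerBl scale1r scalerBr.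
by rewrite addrCA.
Qed.

Lemma omega_ub f g e : F f -> G g -> norm2 (g - f) <= e ->
  ((T g - T f)%:E <= omega T F G e)%E.
Proof. by move=> Ff Gg fge; apply: ereal_sup_ubound; exists f, g. Qed.

Local Notation s := (Num.sqrt (n * V)).

(** In Case 1, [eps] is a maximizer, so its value [K] is the supremum. In Case 2(a), touching gives
    [K = 0], and a zero bias means a zero supremum. A finite positive [eps] excludes the other two
    cases. *)
Lemma is_eps_sup (K : R) : is_eps T F G n V eps%:E -> 0 < eps ->
  omega T F G eps = (K + s * eps)%:E ->
  ereal_sup [set penalized T F G n V e | e in [set e : R | 0 < e]] = K%:E.
Proof.
move=> He eps0 oK.
have pK : penalized T F G n V eps = K%:E.
  by rewrite /penalized oK -EFinB addrK.
have Kle : (K%:E <= ereal_sup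
    [set penalized T F G n V e | e in [set e : R | (0 < e)%R]])%E.
  by apply: ereal_sup_ubound; exists eps.
apply/eqP; rewrite eq_le Kle andbT; case: He.
- move=> [_ [e [<-] [[_ emax] _]]]; apply: ge_ereal_sup => _ [e' /= e'0 <-].
  by rewrite -pK; apply: emax; exact: ltW.
- by case.
- move=> [[b0 _] _ [e [[<-] _ te _]]].
  have K0 : K = 0.
    by move: te; rewrite /omega_touches oK => -[]; lra.
  rewrite K0; move: b0; rewrite /bias => /eqP.
  by rewrite mule_eq0 => /orP[|/eqP->//]; rewrite eqe gt_eqF.
- by move=> [_ [e0] _]; move: eps0; rewrite e0 ltxx.
Qed.

(** Replaces the passage to the limit [t -> 0]. If [x > 0], then [t = 1] gives [A > 0], and
    [t = x / (x + A)] gives [x <= x A / (x + A) < x]. *)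
Lemma le0_small_multiples (x A : R) :
  (forall t, 0 < t <= 1 -> x <= t * A) -> x <= 0.
Proof.
move=> xA; rewrite leNgt; apply/negP => x0.
have A0 : 0 < A by have := xA 1; rewrite ltr01 lexx mul1r => /(_ isT); lra.
have xAx : 0 < x + A by rewrite addr_gt0.
have := xA (x / (x + A)); rewrite divr_gt0// ler_pdivrMr// mul1r lerDl ltW//.
move=> /(_ isT); rewrite mulrAC ler_pdivlMr//; nra.
Qed.

Variables (f g : L2 mu) (B : R).
Hypotheses (linT : linear_functional D T) (FD : F `<=` D) (GD : G `<=` D).
Hypotheses (cF : convex_set F) (cG : convex_set G).
Hypotheses (eps0 : 0 < eps) (Ff : F f) (Gg : G g).
Hypothesis epsE : norm2 (g - f) = eps.
Hypothesis TB : T g - T f = 2 * B + s * eps.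
Hypothesis supB :
  ereal_sup [set penalized T F G n V e | e in [set e : R | 0 < e]] = (2 * B)%:E.

Let u := eps^-1 *: (g - f).
Let a := T (2^-1 *: (f + g)) - s * dot2 u (2^-1 *: (f + g)).

Lemma linear_functionalDZB (f' h : L2 mu) t : D f' -> D h ->
  T (f' + t *: (h - f')) = T f' + t * (T h - T f').
Proof.
case: linT => [[D0 Dl] Tl _] Df Dh.
have T0 : T 0 = 0.
  by have := Tl 1 0 0 D0 D0; rewrite scaler0 addr0 mul1r; lra.
rewrite addrC Tl//; last first.
  by rewrite addrC -scaleN1r; apply: Dl.
rewrite -[h - f']addrC -scaleN1r Tl//; ring.
Qed.

(* AM-GM, [2 eps x <= x^2 + eps^2], linearizes the norm and makes the radius
   positive even when [f' = g']. *)
Lemma modulus_majorant f' g' : F f' -> G g' ->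
  T g' - T f' <= 2 * B + s * ((dot2 (g' - f') (g' - f') + eps ^+ 2) / (2 * eps)).
Proof.
move=> Ff' Gg'; rewrite -sqr_norm2; set x := norm2 _.
have x0 : 0 <= x by exact: norm2_ge0.
set e := _ / _.
have e0 : 0 < e by rewrite divr_gt0 ?mulr_gt0// ltr_wpDl ?sqr_ge0 ?exprn_gt0.
have xe : x <= e.
  rewrite ler_pdivlMr ?mulr_gt0//; have := sqr_ge0 (x - eps); nra.
have : (penalized T F G n V e <= (2 * B)%:E)%E.
  by rewrite -supB; apply: ereal_sup_ubound; exists e.
rewrite /penalized leeBlDr// => /(le_trans (omega_ub Ff' Gg' xe)).
by rewrite -EFinD lee_fin.
Qed.

Lemma dot2gf : dot2 (g - f) (g - f) = eps ^+ 2.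
Proof. by rewrite -sqr_norm2 epsE. Qed.

Lemma dot2_u h : eps * dot2 u h = dot2 (g - f) h.
Proof. by rewrite dot2Zl mulrA divff ?mul1r ?gt_eqF. Qed.

(** Moving [f] to [f + t (h - f)] in [modulus_majorant], which is an equality at [t = 0], leaves
    terms linear in [t] and a remainder in [t^2]; division by [t] isolates the first-order
    inequality. *)
Lemma tangent_F h : F h -> s * dot2 u (h - f) <= T h - T f.
Proof.
move=> Fh; rewrite -subr_le0.
apply: (@le0_small_multiples _ (s * dot2 (h - f) (h - f) / (2 * eps))).
move=> t /andP[t0 t1].
have Ft : F (f + t *: (h - f)) by apply: convex_setP => //; rewrite (ltW t0).
have := modulus_majorant Ft Gg; rewrite linear_functionalDZB; [|exact: FD..].
have -> : g - (f + t *: (h - f)) = g - f + (- t) *: (h - f).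
  by rewrite scaleNr opprD addrA.
rewrite dot2_sqrDZ dot2gf -dot2_u.
set c := dot2 u _; set q := dot2 _ _; set y := T h - T f => H.
have eN0 : eps != 0 by rewrite gt_eqF.
(* Multiplied by [t], the goal becomes the same inequality as [H] once [T g] is replaced by its
   value from [TB]. *)
rewrite -(ler_pM2l t0) -subr_ge0; move: H; rewrite -subr_ge0.
congr (0 <= _); have := TB; move: (T g) => Tg TB'.
have -> : Tg = 2 * B + s * eps + T f by rewrite -TB' subrK.
by field.
Qed.

(** The mirror argument: [g] moves and [f] stays, so the perturbation enters [g - f] with the
    opposite sign. *)
Lemma tangent_G h : G h -> T h - T g <= s * dot2 u (h - g).
Proof.
move=> Gh; rewrite -subr_le0.
apply: (@le0_small_multiples _ (s * dot2 (h - g) (h - g) / (2 * eps))).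
move=> t /andP[t0 t1].
have Gt : G (g + t *: (h - g)) by apply: convex_setP => //; rewrite (ltW t0).
have := modulus_majorant Ff Gt; rewrite linear_functionalDZB; [|exact: GD..].
rewrite [g + _ - f]addrAC dot2_sqrDZ dot2gf -dot2_u.
set c := dot2 u _; set q := dot2 _ _; set y := T h - T g => H.
have eN0 : eps != 0 by rewrite gt_eqF.
rewrite -(ler_pM2l t0) -subr_ge0; move: H; rewrite -subr_ge0.
congr (0 <= _); have := TB; move: (T g) => Tg TB'.
have -> : Tg = 2 * B + s * eps + T f by rewrite -TB' subrK.
by field.
Qed.

Lemma T_midpoint : T (2^-1 *: (f + g)) = 2^-1 * (T f + T g).
Proof.
have Df := FD Ff; have Dg := GD Gg.
have -> : 2^-1 *: (f + g) = f + 2^-1 *: (g - f).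
  rewrite scalerDr scalerBr addrCA [LHS]addrC; congr (_ + _).
  by rewrite -[X in X - _]scale1r -scalerBl; congr (_ *: _); field.
by rewrite linear_functionalDZB//; field.
Qed.

Let Tg : T g = 2 * B + s * eps + T f. Proof. by rewrite -TB subrK. Qed.

Lemma dot2_ug : dot2 u g = eps + dot2 u f.
Proof.
have : dot2 u (g - f) = eps.
  by rewrite dot2Zl dot2gf expr2 mulrA mulVf ?mul1r ?gt_eqF.
by rewrite dot2Dr -scaleN1r dot2Zr => <-; ring.
Qed.

(** The choice of [a] makes the bias vanish at the midpoint of [f] and [g]; going from there to [f]
    adds half of [T g - T f - s * eps], that is [B]. The bracket is nonpositive by [tangent_F]. *)
Lemma affine_bias_F h :
  a + s * dot2 u h - T h = B + (s * dot2 u (h - f) - (T h - T f)).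
Proof.
rewrite /a T_midpoint dot2Zr !dot2Dr -[- f]scaleN1r dot2Zr dot2_ug Tg.
by field.
Qed.

Lemma affine_bias_G h :
  a + s * dot2 u h - T h = - B + (s * dot2 u (h - g) - (T h - T g)).
Proof.
rewrite /a T_midpoint dot2Zr !dot2Dr -[- g]scaleN1r dot2Zr dot2_ug Tg.
by field.
Qed.

Lemma sup_bias_F : ereal_sup [set (a + s * dot2 u h - T h)%:E | h in F] = B%:E.
Proof.
apply/eqP; rewrite eq_le; apply/andP; split.
  apply: ge_ereal_sup => _ [h Fh <-]; rewrite lee_fin affine_bias_F gerDl.
  by rewrite subr_le0 tangent_F.
apply: ereal_sup_ubound; exists f => //.
rewrite affine_bias_F !subrr -[X in dot2 _ X](scale0r f) dot2Zr.
by congr EFin; ring.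
Qed.

Lemma inf_bias_G :
  ereal_inf [set (a + s * dot2 u h - T h)%:E | h in G] = (- B)%:E.
Proof.
apply/eqP; rewrite eq_le; apply/andP; split.
  apply: ereal_inf_lbound; exists g => //.
  rewrite affine_bias_G !subrr -[X in dot2 _ X](scale0r f) dot2Zr.
  by congr EFin; ring.
apply: le_ereal_inf_tmp => _ [h Gh <-]; rewrite lee_fin affine_bias_G lerDl.
by rewrite subr_ge0 tangent_G.
Qed.

End minimax_bias.

(** * The affine estimator, for any statistic with the right mean and variance *)

Section estimator.
Context d (X : measurableType d) (R : realType) (mu : {measure set X -> \bar R}).
Context dO (Omega : measurableType dO) (P : L2 mu -> probability Omega R).
Variables (T : L2 mu -> R) (D F G : set (L2 mu)) (n V eps : R).
Variables (f g : L2 mu) (Z : {mfun Omega >-> R}).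

Let u := eps^-1 *: (g - f).
Let a := T (2^-1 *: (f + g)) - Num.sqrt (n * V) * dot2 u (2^-1 *: (f + g)).
Let That := fun w => a + Num.sqrt (n * V) * Z w.

(** Shared by the two models, which enter only through the square integrability, mean and variance
    of [Z] under each [P h]. *)
Lemma minimax_affine_estimator :
  0 < n -> 0 <= V ->
  linear_functional D T -> F `<=` D -> G `<=` D ->
  convex_set F -> convex_set G ->
  is_eps T F G n V eps%:E -> 0 < eps ->
  F f -> G g -> norm2 (g - f) = eps ->
  (T g - T f)%:E = omega T F G eps ->
  (forall h, (Z : Omega -> R) \in Lfun (P h) 2%:E) ->
  (forall h, 'E_(P h)[Z] = (dot2 u h)%:E)%E ->
  (forall h, 'V_(P h)[Z] = (n^-1 * dot2 u u)%:E) ->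
  [/\ forall h, 'V_(P h)[That] = V%:E,
      ereal_sup [set ('E_(P h)[That] - (T h)%:E)%E | h in F] = bias T F G n V &
      ereal_inf [set ('E_(P h)[That] - (T h)%:E)%E | h in G] =
        (- bias T F G n V)%E].
Proof.
move=> n0 V0 linT FD GD cF cG He eps0 Ff Gg epsE To Z2 EZ VZ.
have ThatE : That = cst a \+ (Num.sqrt (n * V) \o* Z).
  by apply/funext => w /=; rewrite mulrC.
have cZ2 h : (Num.sqrt (n * V) \o* Z) \in Lfun (P h) 2%:E.
  by apply: Lfun_scale => //; rewrite ler1n.
have L21 h (Y : Omega -> R) : Y \in Lfun (P h) 2%:E -> Y \in Lfun (P h) 1.
  by apply: Lfun_subset12; exact: fin_num_measure.
have EThat h : ('E_(P h)[That] = (a + Num.sqrt (n * V) * dot2 u h)%:E)%E.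
  rewrite ThatE expectationD; [|exact: Lfun_cst|exact: L21].
  by rewrite expectation_cst expectationZl ?EZ//; exact: L21.
(* Half the penalized modulus at [eps]; the factor 1/2 is the one in [bias]. *)
pose B := 2^-1 * (T g - T f - Num.sqrt (n * V) * eps).
have TB : T g - T f = 2 * B + Num.sqrt (n * V) * eps by rewrite /B; field.
have supB : ereal_sup [set penalized T F G n V e | e in [set e : R | 0 < e]] =
    (2 * B)%:E.
  by apply: is_eps_sup He eps0 _; rewrite -To TB.
have biasE : bias T F G n V = B%:E.
  by rewrite /bias supB -EFinM mulrA mulVf ?mul1r.
split.
- move=> h; rewrite ThatE varianceD_cst_l ?varianceZ// VZ -EFinM.
  rewrite sqr_sqrtr ?mulr_ge0 ?(ltW n0)//; congr EFin.
  (* Since [u] has norm 1, the variance is [n * V] times [n^-1]. *)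
  rewrite /u dot2Zl dot2Zr -sqr_norm2 epsE.
  by field; rewrite !gt_eqF.
- rewrite biasE; rewrite -(sup_bias_F linT FD GD cF eps0 Ff Gg epsE TB supB).
  by congr ereal_sup; apply: eq_imagel => h _; rewrite EThat.
- rewrite biasE -EFinN -(inf_bias_G linT FD GD cG eps0 Ff Gg epsE TB supB).
  by congr ereal_inf; apply: eq_imagel => h _; rewrite EThat.
Qed.

End estimator.

Theorem theorem2 (R : realType) (n : R) (hn : 0 < n) (V : R) (hV : 0 <= V) :
  (* white noise model on the interval I *)
  (forall (I : interval R) (dO : measure_display) (Omega : measurableType dO)
      (P : L2_itv R I -> probability Omega R) (Y : R -> {mfun Omega >-> R})
      (D : set (L2_itv R I)) (T : L2_itv R I -> R) (F G : set (L2_itv R I))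
      (epsV : R) (f g : L2_itv R I) (intuY : {mfun Omega >-> R}),
    (forall h, white_noise (P h) I n h Y) ->
    linear_functional D T -> F `<=` D -> G `<=` D ->
    convex_set F -> convex_set G -> closed2 F -> closed2 G ->
    F `&` G !=set0 -> (0 < omega T F G 1)%E ->
    is_eps T F G n V epsV%:E -> 0 < epsV ->
    F f -> G g -> norm2 (g - f) = epsV ->
    (T g - T f)%:E = omega T F G epsV ->
    let u := epsV^-1 *: (g - f) in
    let a := T (2^-1 *: (f + g)) - Num.sqrt (n * V) * dot2 u (2^-1 *: (f + g)) in
    (forall h, is_stoch_integral (P h) I Y u intuY) ->
    let That := fun w => a + Num.sqrt (n * V) * intuY w in
    [/\ forall h, 'V_(P h)[That] = V%:E,
        ereal_sup [set ('E_(P h)[That] - (T h)%:E)%E | h in F] = bias T F G n V &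
        ereal_inf [set ('E_(P h)[That] - (T h)%:E)%E | h in G] =
          (- bias T F G n V)%E])
  /\
  (* sequence model *)
  (forall (dO : measure_display) (Omega : measurableType dO)
      (P : l2 R -> probability Omega R) (Y : nat -> {mfun Omega >-> R})
      (D : set (l2 R)) (T : l2 R -> R) (F G : set (l2 R))
      (epsV : R) (f g : l2 R) (sumuY : {mfun Omega >-> R}),
    (forall h, gaussian_sequence (P h) n h Y) ->
    linear_functional D T -> F `<=` D -> G `<=` D ->
    convex_set F -> convex_set G -> closed2 F -> closed2 G ->
    F `&` G !=set0 -> (0 < omega T F G 1)%E ->
    is_eps T F G n V epsV%:E -> 0 < epsV ->
    F f -> G g -> norm2 (g - f) = epsV ->
    (T g - T f)%:E = omega T F G epsV ->
    let u := epsV^-1 *: (g - f) in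
    let a := T (2^-1 *: (f + g)) - Num.sqrt (n * V) * dot2 u (2^-1 *: (f + g)) in
    (forall h, is_series_sum (P h) Y u sumuY) ->
    let That := fun w => a + Num.sqrt (n * V) * sumuY w in
    [/\ forall h, 'V_(P h)[That] = V%:E,
        ereal_sup [set ('E_(P h)[That] - (T h)%:E)%E | h in F] = bias T F G n V &
        ereal_inf [set ('E_(P h)[That] - (T h)%:E)%E | h in G] =
          (- bias T F G n V)%E]).
Proof.
split.
- move=> I dO Omega P Y D T F G epsV f g intuY YE linT FD GD cF cG _ _ _ _ He.
  move=> epsV0 Ff Gg epsE To u a uY That.
  have H h := white_noise_stoch_integral hn (YE h) (uY h).
  by apply: (minimax_affine_estimator hn hV linT FD GD cF cG He) => // h;
    case: (H h).
- move=> dO Omega P Y D T F G epsV f g sumuY YE linT FD GD cF cG _ _ _ _ He.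
  move=> epsV0 Ff Gg epsE To u a uY That.
  have H h := gaussian_sequence_series hn (YE h) (uY h).
  by apply: (minimax_affine_estimator hn hV linT FD GD cF cG He) => // h;
    case: (H h).
Qed.
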